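(* Let $(A_0,A)\in SM_d(\mathbb{R})^{g+1}$ and assume $\mathcal{H}_{(A_0,A)}$ is a positive homogeneous free spectrahedron. Then one has the following. (1) The homogeneous component $A_0$ is positive semidefinite. Furthermore, if $(A_0,A)$ is a minimal defining tuple for $\mathcal{H}_{(A_0,A)}$, then $A_0\succ0$. (2) If $\mathcal{H}_{(A_0,A)}$ is bounded, then for any $(X_0,X)\in\mathcal{H}_{(A_0,A)}$ one has $$X_0\succeq0\qquad\text{and}\qquad X_0^{\dagger/2}XX_0^{\dagger/2}\in\mathfrak{H}^{-1}(\mathcal{H}_{(A_0,A)})$$ and $\ker X_0\subseteq\ker X_i$ for all $i=1,\dots,g$. Here $X_0^{\dagger/2}$ is the positive semidefinite square root of the Moore-Penrose pseudoinverse of $X_0$. (3) If $\mathcal{H}_{(A_0,A)}$ is bounded, then the tuple $(A_0,A)$ is a minimal defining tuple for $\mathcal{H}_{(A_0,A)}$ if and only if $A_0\succ0$ and $A_0^{-1/2}AA_0^{-1/2}$ is a minimal defining tuple for $\mathfrak{H}^{-1}(\mathcal{H}_{(A_0,A)})$. (4) A bounded homogeneous free spectrahedron is positive if and only if it can be expressed as the homogenization of a bounded free spectrahedron. (In this item the homogeneous free spectrahedron is not assumed positive.)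
   Context: $SM_n(\mathbb{R})^g$ is the set of $g$-tuples of real symmetric $n\times n$ matrices, $SM(\mathbb{R})^g=\bigcup_nSM_n(\mathbb{R})^g$. Products $VXW$ and direct sums of tuples are coordinatewise. For $(A_0,A)=(A_0,A_1,\dots,A_g)\in SM_d(\mathbb{R})^{g+1}$ let $\Lambda_{(A_0,A)}(X_0,X)=\sum_{i=0}^gA_i\otimes X_i$. The homogeneous free spectrahedron is $\mathcal{H}_{(A_0,A)}=\{(X_0,X)\in SM(\mathbb{R})^{g+1}:\Lambda_{(A_0,A)}(X_0,X)\succeq0\}$, and $\mathcal{H}_{(A_0,A)}(n)$ is its intersection with $SM_n(\mathbb{R})^{g+1}$. It is positive if $(1,0,\dots,0)\in\mathbb{R}^{g+1}$ lies in the interior of $\mathcal{H}_{(A_0,A)}(1)$. Set $\mathfrak{H}^{-1}(\mathcal{H}_{(A_0,A)})=\{X\in SM(\mathbb{R})^g:(I,X)\in\mathcal{H}_{(A_0,A)}\}$. For $A\in SM_d(\mathbb{R})^g$ the free spectrahedron is $\mathcal{D}_A=\{X\in SM(\mathbb{R})^g:L_A(X)\succeq0\}$ with $L_A(X)=I+\sum_{i=1}^gA_i\otimes X_i$. When $A_0\succ0$, $\mathfrak{H}^{-1}(\mathcal{H}_{(A_0,A)})=\mathcal{D}_{A_0^{-1/2}AA_0^{-1/2}}$. A set $K\subseteq SM(\mathbb{R})^g$ is bounded if there is $C>0$ with $C\,I-\sum_{i=1}^gX_i^2\succeq0$ for all $X\in K$; $\mathcal{H}_{(A_0,A)}$ is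 called bounded if $\mathfrak{H}^{-1}(\mathcal{H}_{(A_0,A)})$ is bounded. Minimal defining tuples: if $U$ is orthogonal with $U^T(A_0,A)U=(A_0^1,A^1)\oplus(A_0^2,A^2)$, the pencils $\Lambda_{(A_0^i,A^i)}$ are subpencils of $\Lambda_{(A_0,A)}$, and such a subpencil is a defining subpencil for $\mathcal{H}_{(A_0,A)}$ if $\mathcal{H}_{(A_0^i,A^i)}=\mathcal{H}_{(A_0,A)}$. $(A_0,A)\in SM_d(\mathbb{R})^{g+1}$ is a minimal defining tuple for $\mathcal{H}_{(A_0,A)}$ if for every invertible $V\in M_d(\mathbb{R})$ no proper subpencil of $\Lambda_{V^T(A_0,A)V}$ is a defining subpencil for $\mathcal{H}_{(A_0,A)}$. Analogously, if $U^TAU=A^1\oplus A^2$ with $U$ orthogonal, $L_{A^1},L_{A^2}$ are subpencils of $L_A$, and $A$ is a minimal defining tuple for $\mathcal{D}_A$ if no proper subpencil $L_{A^i}$ of $L_A$ satisfies $\mathcal{D}_{A^i}=\mathcal{D}_A$. The homogenization of a free spectrahedron $\mathcal{D}_A$ is $\mathfrak{H}(\mathcal{D}_A)=\mathcal{H}_{(I,\check A)}$, where $\check A$ is any minimal defining tuple for $\mathcal{D}_A$ (this is independent of the choice). *)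

(* Defs.v *)
From HB Require Import structures.
From mathcomp Require Import all_boot all_order all_algebra.
From mathcomp Require Import all_classical all_reals all_analysis.
From mathcomp Require Import mxtens.
Import Order.TTheory GRing.Theory Num.Theory.
Import numFieldNormedType.Exports.

Set Implicit Arguments.
Unset Strict Implicit.
Unset Printing Implicit Defensive.

Local Open Scope classical_set_scope.
Local Open Scope ring_scope.

Section Matrices.
Variable R : realType.

Definition psdmx n (M : 'M[R]_n) : Prop :=
  M \is symmetricmx /\ forall v : 'cV[R]_n, 0 <= (v^T *m M *m v) 0 0.

Definition pdmx n (M : 'M[R]_n) : Prop :=
  M \is symmetricmx /\
  forall v : 'cV[R]_n, v != 0 -> 0 < (v^T *m M *m v) 0 0.

(* The unique positive semidefinite square root of M when M is positive
   semidefinite (0 if there is none). *)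
Definition psd_sqrtmx n (M : 'M[R]_n) : 'M[R]_n :=
  xget 0 [set S | psdmx S /\ S *m S = M].

(* Not to be confused with pinvmx, which is only a partial inverse. *)
Definition moore_penrose n (M : 'M[R]_n) : 'M[R]_n :=
  xget 0 [set P | [/\ M *m P *m M = M, P *m M *m P = P,
                      M *m P \is symmetricmx & P *m M \is symmetricmx]].

End Matrices.

Section Tuples.
Variable R : realType.

Definition mxtuple (k n : nat) : Type := 'I_k -> 'M[R]_n.

Definition symtuple k n (X : mxtuple k n) : Prop :=
  forall i, X i \is symmetricmx.

Definition tuple_mul k m n (V : 'M[R]_(m, n)) (X : mxtuple k n)
    (W : 'M[R]_(n, m)) : mxtuple k m :=
  fun i => V *m X i *m W.

Definition tuple_dsum k m n (X : mxtuple k m) (Y : mxtuple k n) :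
    mxtuple k (m + n) :=
  fun i => block_mx (X i) 0 0 (Y i).

(* The tuple (X_0, X) = (X_0, X_1, ..., X_g). *)
Definition tuple_cons g n (X0 : 'M[R]_n) (X : mxtuple g n) : mxtuple g.+1 n :=
  fun i => if unlift ord0 i is Some j then X j else X0.

(* A subset of SM(R)^k, given by its levels. *)
Definition free_set (k : nat) : Type := forall n : nat, set (mxtuple k n).

Definition hom_pencil k d n (A : mxtuple k d) (X : mxtuple k n) :
    'M[R]_(d * n) :=
  \sum_(i < k) (A i *t X i).

Definition hom_free_spectrahedron k d (A : mxtuple k d) : free_set k :=
  fun n => [set X | symtuple X /\ psdmx (hom_pencil A X)].

Definition monic_pencil g d n (A : mxtuple g d) (X : mxtuple g n) :
    'M[R]_(d * n) :=
  1%:M + \sum_(i < g) (A i *t X i).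

Definition free_spectrahedron g d (A : mxtuple g d) : free_set g :=
  fun n => [set X | symtuple X /\ psdmx (monic_pencil A X)].

(* 1 x 1 tuples are identified with points of R^(g+1), topologized as a space
   of row vectors; delta_mx 0 0 is (1, 0, ..., 0). *)
Definition positive_free_set g (H : free_set g.+1) : Prop :=
  ([set x : 'rV[R]_g.+1 | H 1%N (fun i => (x 0 i)%:M)])°
    (delta_mx 0 0 : 'rV[R]_g.+1).

Definition dehomogenization g (H : free_set g.+1) : free_set g :=
  fun n => [set X | H n (tuple_cons 1%:M X)].

Definition bounded_free_set g (K : free_set g) : Prop :=
  exists2 C : R, 0 < C &
    forall n (X : mxtuple g n), K n X ->
      psdmx (C%:M - \sum_(i < g) X i *m X i).

Definition hom_bounded g (H : free_set g.+1) : Prop :=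
  bounded_free_set (dehomogenization H).

(* U^T A U = B (+) C for an orthogonal U.  The number of columns of U is the
   sum of the block sizes; the first two equations force it to be d. *)
Definition orth_split k d e f (A : mxtuple k d) (B : mxtuple k e)
    (C : mxtuple k f) : Prop :=
  exists U : 'M[R]_(d, e + f),
    [/\ U^T *m U = 1%:M, U *m U^T = 1%:M
      & tuple_mul U^T A U = tuple_dsum B C].

(* A summand may have size 0: the empty pencil is positive semidefinite
   everywhere, so that it, and not the 1 x 1 zero tuple, is the minimal
   defining tuple of the whole space. *)
Definition subpencil k d e (B : mxtuple k e) (A : mxtuple k d) : Prop :=
  exists (f : nat) (C : mxtuple k f), orth_split A B C \/ orth_split A C B.

Definition proper_subpencil k d e (B : mxtuple k e) (A : mxtuple k d) : Prop :=
  subpencil B A /\ (e < d)%N.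

Definition hom_minimal_defining k d (A : mxtuple k d) (H : free_set k) : Prop :=
  hom_free_spectrahedron A = H /\
  forall V : 'M[R]_d, V \in unitmx ->
  forall e (B : mxtuple k e), proper_subpencil B (tuple_mul V^T A V) ->
    hom_free_spectrahedron B <> H.

Definition minimal_defining g d (A : mxtuple g d) (D : free_set g) : Prop :=
  free_spectrahedron A = D /\
  forall e (B : mxtuple g e), proper_subpencil B A ->
    free_spectrahedron B <> D.

(* H is the homogenization of the free spectrahedron D.  The set H does not
   depend on which minimal defining tuple of D is taken. *)
Definition homogenization_of g (D : free_set g) (H : free_set g.+1) : Prop :=
  exists (d : nat) (A : mxtuple g d),
    [/\ symtuple A, minimal_defining A D
      & H = hom_free_spectrahedron (tuple_cons 1%:M A)].

End Tuples.

(* Main.v *)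
Require Import Defs.
From HB Require Import structures.
From mathcomp Require Import all_boot all_order all_algebra.
From mathcomp Require Import all_classical all_reals all_analysis.
From mathcomp Require Import mxtens complex spectral sesquilinear lra.
Import Order.TTheory GRing.Theory Num.Theory.
Import numFieldNormedType.Exports.
Local Open Scope ring_scope.

(* Positivity of H gives A0 +- t A_j >= 0 for small t, hence A0 >= 0 and
   ker A0 <= ker A_j; splitting off ker A0 leaves a positive definite A0 without
   changing H.  If H is bounded, a member (0, Y) of H has Y = 0, since (I, tY) is
   in H for all t >= 0.  Applied to compressions of (X0, X) in H, this yields
   X0 >= 0 and, with positivity of the pencil, ker X0 <= ker X_i.  Compressing by
   X0^{+/2} and back then shows that a bounded H is determined by its
   dehomogenization, so that splittings of (A0, A) under congruence correspond to
   orthogonal splittings of A0^{-1/2} A A0^{-1/2}. *)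

Lemma symmetricmxP {R : fieldType} {n} {M : 'M[R]_n} :
  reflect (M^T = M) (M \is symmetricmx).
Proof.
by apply: (iffP (is_hermitianmxP _ _ _)); rewrite expr0 scale1r map_mx_id.
Qed.

(** Over the complex numbers the matrix is Hermitian, so its spectral diagonal is real. A real root
    of the complex characteristic polynomial is a root of the real one, since the polynomial has
    real coefficients. *)
Lemma real_symmetric_eigenvalue {R : realType} {n} {M : 'M[R]_n.+1} :
  M^T = M -> exists a, eigenvalue M a.
Proof.
move=> Msym.
pose Mc : 'M[R[i]]_n.+1 := map_mx (real_complex R) M.
have Mherm : Mc \is hermsymmx.
  apply: realsym_hermsym; first by apply/symmetricmxP; rewrite map_trmx Msym.
  by apply/mxOverP => i j; rewrite mxE complex_real.
have /orthomx_spectralP Mdiag := hermitian_normalmx Mherm.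
have Punit := spectral_unit Mc.
have /mxOverP/(_ 0 0)/complex_realP[a aE] := hermitian_spectral_diag_real Mherm.
set P := spectralmx Mc in Mdiag Punit; set D := spectral_diag Mc in Mdiag aE.
exists a.
have : eigenvalue Mc (real_complex R a).
  apply/eigenvalueP; exists (row 0 P); last first.
    apply/eqP => /(congr1 (mulmx^~ (invmx P))).
    rewrite rowE mulmxK // mul0mx => /matrixP/(_ 0 0)/eqP.
    by rewrite !mxE !eqxx oner_eq0.
  rewrite -row_mul {1}Mdiag !mulmxA mulmxV // mul1mx row_mul row_diag_mx.
  by rewrite -scalemxAl -rowE aE.
by rewrite !eigenvalue_root_char -map_char_poly fmorph_root.
Qed.

Lemma mulmx_tr_self {R : realType} {n} (v : 'rV[R]_n) :
  (v *m v^T) 0 0 = \sum_j v 0 j ^+ 2.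
Proof. by rewrite mxE; apply: eq_bigr => j _; rewrite mxE expr2. Qed.

Lemma mulmx_tr_self_ge0 {R : realType} {n} (v : 'rV[R]_n) :
  0 <= (v *m v^T) 0 0.
Proof. by rewrite mulmx_tr_self sumr_ge0 // => j _; exact: sqr_ge0. Qed.

Lemma mulmx_tr_self_eq0 {R : realType} {n} (v : 'rV[R]_n) :
  ((v *m v^T) 0 0 == 0) = (v == 0).
Proof.
rewrite mulmx_tr_self; apply/idP/eqP => [|->]; last first.
  by rewrite big1 // => j _; rewrite mxE expr0n.
rewrite psumr_eq0 => [/allP v0|j _]; last exact: sqr_ge0.
apply/rowP => j; rewrite mxE; apply/eqP.
by rewrite -sqrf_eq0; apply: v0; rewrite mem_index_enum.
Qed.

Lemma orthogonal_of_unit_row {R : realType} {n} {v : 'rV[R]_n.+1} :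
  v *m v^T = 1%:M ->
  exists U : 'M[R]_n.+1, [/\ U^T = U, U *m U = 1%:M & row 0 U = v].
Proof.
move=> v1; pose e : 'rV[R]_n.+1 := delta_mx 0 0; pose w := e - v.
have e1 : e *m e^T = 1%:M.
  by apply/matrixP => i j; rewrite !ord1 /e trmx_delta mul_delta_mx !mxE.
pose c := 2 / (w *m w^T) 0 0.
have ww : w *m w^T = ((w *m w^T) 0 0)%:M by rewrite -mx11_scalar.
(* the Householder reflection exchanging e and v; the identity when v = e,
   as then c = 2 / 0 = 0 *)
pose U : 'M[R]_n.+1 := 1%:M - c *: (w^T *m w).
have wU : w *m U = (1 - c * (w *m w^T) 0 0) *: w.
  rewrite /U mulmxBr mulmx1 -scalemxAr mulmxA ww mul_scalar_mx !mxE eqxx.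
  by rewrite mulr1n scalerA scalerBl scale1r.
have [w0|wN0] := eqVneq w 0.
  exists 1%:M; rewrite trmx1 mul1mx; split => //.
  by rewrite rowE mulmx1; apply/eqP; rewrite -subr_eq0 -/e -/w w0.
have s0 : (w *m w^T) 0 0 != 0 by rewrite mulmx_tr_self_eq0.
have cs : c * (w *m w^T) 0 0 = 2 by rewrite /c divfK.
have wUN : w *m U = - w.
  by rewrite wU cs -[RHS]scaleN1r; congr (_ *: _); lra.
exists U; split.
- by rewrite /U linearB /= linearZ /= trmx_mul trmxK trmx1.
- rewrite {1}/U mulmxBl mul1mx -scalemxAl -mulmxA wUN mulmxN scalerN opprK.
  by rewrite /U subrK.
- (* w w^T = 2 - 2 e v^T = 2 e w^T *)
  have ev : v *m e^T = e *m v^T.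
    rewrite -[RHS]trmxK trmx_mul trmxK.
    by apply/matrixP => i j; rewrite !ord1 [RHS]mxE.
  have ew : e *m w^T = (2^-1 * (w *m w^T) 0 0)%:M.
    rewrite [LHS]mx11_scalar; congr (_%:M).
    rewrite /w linearB /= !mulmxBr !mulmxBl ev e1 v1 !mxE eqxx; lra.
  rewrite rowE -/e /U mulmxBr mulmx1 -scalemxAr mulmxA ew mul_scalar_mx scalerA.
  have -> : c * (2^-1 * (w *m w^T) 0 0) = 1.
    by rewrite mulrCA cs mulVf // pnatr_eq0.
  by rewrite scale1r /w opprB addrC subrK.
Qed.

Lemma real_symmetric_diagonalization {R : realType} {n} {M : 'M[R]_n} :
  M^T = M -> exists (U : 'M[R]_n) (D : 'rV[R]_n),
    [/\ U *m U^T = 1%:M, U^T *m U = 1%:M & M = U^T *m diag_mx D *m U].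
Proof.
elim: n M => [|n IHn] M Msym.
  by exists 1%:M, 0; split; rewrite ?[LHS]thinmx0 ?[RHS]thinmx0 // flatmx0 thinmx0.
have [a /eigenvalueP[v va vN0]] := real_symmetric_eigenvalue Msym.
pose s := Num.sqrt ((v *m v^T) 0 0).
have sN0 : s != 0.
  rewrite sqrtr_eq0 -ltNge lt_neqAle eq_sym mulmx_tr_self_eq0 vN0.
  exact: mulmx_tr_self_ge0.
pose u := s^-1 *: v.
have u1 : u *m u^T = 1%:M.
  rewrite /u linearZ /= -scalemxAl -scalemxAr scalerA [v *m _]mx11_scalar.
  rewrite scale_scalar_mx -(sqr_sqrtr (mulmx_tr_self_ge0 v)) -/s.
  by congr (_%:M); rewrite -expr2 -exprMn mulVf // expr1n.
have uM : u *m M = a *: u by rewrite /u -scalemxAl va !scalerA mulrC.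
have [U [Usym UU U0]] := orthogonal_of_unit_row u1.
(* [N] is kept opaque. Its first row is [a] times the first basis vector, symmetry then clears the
   first column, and the remaining block goes to the induction hypothesis. *)
have [N defN] : {N | N = U *m M *m U} by exists (U *m M *m U).
have Nsym : N^T = N by rewrite defN !trmx_mul Msym Usym mulmxA.
have N0 : row 0 N = a *: delta_mx 0 0.
  by rewrite defN !row_mul U0 uM -scalemxAl -U0 -row_mul UU rowE mulmx1.
have Nblock : N = (block_mx a%:M 0 0 (@drsubmx _ 1 n 1 n N) : 'M[R]_(1 + n)).
  have dl : @dlsubmx _ 1 n 1 n N = 0.
    apply/matrixP => i j; rewrite !mxE -Nsym mxE.
    move/rowP/(_ (rshift 1 i)): N0; rewrite !mxE ord1 lshift0 => ->.
    by rewrite mulr0.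
  have ur : @ursubmx _ 1 n 1 n N = 0.
    by rewrite -[LHS]trmxK trmx_ursub Nsym dl trmx0.
  have ul : @ulsubmx _ 1 n 1 n N = a%:M.
    apply/matrixP => i j; rewrite !ord1 !mxE !lshift0.
    by move/rowP/(_ 0): N0; rewrite !mxE !eqxx mulr1.
  by rewrite -[LHS](@submxK _ 1 n 1 n) dl ur ul.
have [|V [D [VV VV' VD]]] := IHn (@drsubmx _ 1 n 1 n N).
  by rewrite trmx_drsub Nsym.
pose W : 'M[R]_(1 + n) := block_mx 1%:M 0 0 V.
have trW : W^T = block_mx 1%:M 0 0 V^T by rewrite /W tr_block_mx trmx1 !trmx0.
have WW : W *m W^T = 1%:M.
  rewrite trW mulmx_block !mulmx0 !mul0mx !addr0 !add0r VV mulmx1.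
  by rewrite -scalar_mx_block.
have WW' : W^T *m W = 1%:M by exact: mulmx1C.
have NW : N = (W^T *m diag_mx (row_mx a%:M D) *m W : 'M[R]_(1 + n)).
  have -> : diag_mx (row_mx a%:M D) = block_mx a%:M 0 0 (diag_mx D).
    rewrite diag_mx_row; congr (block_mx _ 0 0 _).
    by apply/matrixP => i j; rewrite !mxE !ord1.
  rewrite Nblock trW !mulmx_block !mulmx0 !mul0mx !addr0 !add0r.
  by rewrite mul1mx mulmx1 -VD !mul0mx.
exists (W *m U), (row_mx a%:M D); split.
- by rewrite trmx_mul Usym mulmxA -(mulmxA W) UU mulmx1.
- by rewrite trmx_mul Usym -mulmxA (mulmxA _ W) WW' mul1mx.
have -> : M = U *m N *m U by rewrite defN !mulmxA UU mul1mx -mulmxA UU mulmx1.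
by rewrite trmx_mul Usym NW !mulmxA.
Qed.

(** * Positive semidefinite matrices, square roots and pseudoinverses *)

Lemma psdmx_tr {R : realType} {n} {M : 'M[R]_n} : psdmx M -> M^T = M.
Proof. by case=> /symmetricmxP. Qed.

(** The diagonal entries of [V^T *m V] are the squared norms of the columns of [V]. *)
Lemma gram_eq0 {R : realType} {m n} {V : 'M[R]_(m, n)} :
  V^T *m V = 0 -> V = 0.
Proof.
move=> VV; apply: trmx_inj; rewrite trmx0; apply/row_matrixP => i.
rewrite row0; apply/eqP; rewrite -mulmx_tr_self_eq0.
have -> : (row i V^T *m (row i V^T)^T) 0 0 = (V^T *m V) i i.
  by rewrite !mxE; apply: eq_bigr => j _; rewrite !mxE.
by rewrite VV mxE.
Qed.

Lemma psdmx_gram {R : realType} {m n} (V : 'M[R]_(m, n)) : psdmx (V^T *m V).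
Proof.
split=> [|v]; first by apply/symmetricmxP; rewrite trmx_mul trmxK.
by have := mulmx_tr_self_ge0 (V *m v)^T; rewrite trmxK trmx_mul !mulmxA.
Qed.

Lemma psdmx_congr {R : realType} {m n} {M : 'M[R]_m} (V : 'M[R]_(m, n)) :
  psdmx M -> psdmx (V^T *m M *m V).
Proof.
move=> Mpsd; split=> [|v].
  by apply/symmetricmxP; rewrite !trmx_mul trmxK (psdmx_tr Mpsd) mulmxA.
by have := Mpsd.2 (V *m v); rewrite trmx_mul !mulmxA.
Qed.

Lemma psdmx_diag_ge0 {R : realType} {n} {M : 'M[R]_n} (i : 'I_n) :
  psdmx M -> 0 <= M i i.
Proof.
move=> /(psdmx_congr (delta_mx i (0 : 'I_1)))[_ /(_ 1%:M)].
by rewrite trmx1 mul1mx mulmx1 trmx_delta -rowE -colE !mxE.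
Qed.

Lemma psdmxD {R : realType} {n} {M N : 'M[R]_n} :
  psdmx M -> psdmx N -> psdmx (M + N).
Proof.
move=> Mpsd Npsd; split=> [|v].
  by apply/symmetricmxP; rewrite linearD /= (psdmx_tr Mpsd) (psdmx_tr Npsd).
by rewrite mulmxDr mulmxDl mxE addr_ge0 ?(Mpsd.2 v) ?(Npsd.2 v).
Qed.

Lemma psdmxZ {R : realType} {n} {M : 'M[R]_n} {a : R} :
  0 <= a -> psdmx M -> psdmx (a *: M).
Proof.
move=> a_ge0 Mpsd; split=> [|v].
  by apply/symmetricmxP; rewrite linearZ /= (psdmx_tr Mpsd).
by rewrite -scalemxAr -scalemxAl mxE mulr_ge0 ?(Mpsd.2 v).
Qed.

Lemma psdmx0 {R : realType} {n} : psdmx (0 : 'M[R]_n).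
Proof. by rewrite -(mulmx0 _ (0 : 'M[R]_n)^T); exact: psdmx_gram. Qed.

Lemma psdmx1 {R : realType} {n} : psdmx (1%:M : 'M[R]_n).
Proof. by rewrite -[1%:M]mulmx1 -{1}trmx1; exact: psdmx_gram. Qed.

Lemma psdmx_diag {R : realType} {n} {D : 'rV[R]_n} :
  (forall i, 0 <= D 0 i) -> psdmx (diag_mx D).
Proof.
move=> D_ge0.
have -> : diag_mx D =
    (diag_mx (map_mx Num.sqrt D))^T *m diag_mx (map_mx Num.sqrt D).
  rewrite tr_diag_mx mulmx_diag; congr diag_mx; apply/rowP => i.
  by rewrite !mxE -expr2 sqr_sqrtr.
exact: psdmx_gram.
Qed.

(** [xget] meets its specification once a witness exists. The witness takes roots of the
    eigenvalues, which are nonnegative as diagonal entries of a congruent matrix. *)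
Lemma psd_sqrtmxP {R : realType} {n} {M : 'M[R]_n} : psdmx M ->
  psdmx (psd_sqrtmx M) /\ psd_sqrtmx M *m psd_sqrtmx M = M.
Proof.
move=> Mpsd; apply: (xgetPex 0 (P := [set S | psdmx S /\ S *m S = M]%classic)).
have [U [D [UU UU' MD]]] := real_symmetric_diagonalization (psdmx_tr Mpsd).
have D_ge0 i : 0 <= D 0 i.
  have /(psdmx_diag_ge0 i) := psdmx_congr U^T Mpsd.
  rewrite MD trmxK !mulmxA UU mul1mx -mulmxA UU mulmx1.
  by rewrite mxE eqxx mulr1n.
exists (U^T *m diag_mx (map_mx Num.sqrt D) *m U); split.
  by apply/psdmx_congr/psdmx_diag => i; rewrite mxE sqrtr_ge0.
rewrite !mulmxA -(mulmxA _ U) UU mulmx1 -(mulmxA U^T) mulmx_diag MD.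
by congr (_ *m diag_mx _ *m _); apply/rowP => i; rewrite !mxE -expr2 sqr_sqrtr.
Qed.

(** With [S] the square root of [M], the matrix [V^T *m M *m V] is the Gram matrix of [S *m V]. *)
Lemma psdmx_congr_eq0 {R : realType} {m n} {M : 'M[R]_m} {V : 'M[R]_(m, n)} :
  psdmx M -> V^T *m M *m V = 0 -> M *m V = 0.
Proof.
move=> /psd_sqrtmxP[Spsd SS] VMV; rewrite -SS -mulmxA.
have -> : psd_sqrtmx M *m V = 0; last by rewrite mulmx0.
by apply: gram_eq0; rewrite trmx_mul (psdmx_tr Spsd) mulmxA -(mulmxA V^T) SS.
Qed.

(** If [A] and [B] are squares of symmetric [S] and [T], then [A *t B] is the Gram matrix of
    [S *t T]. *)
Lemma psdmx_tens {R : realType} {m n} {A : 'M[R]_m} {B : 'M[R]_n} :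
  psdmx A -> psdmx B -> psdmx (A *t B).
Proof.
move=> /psd_sqrtmxP[Spsd SS] /psd_sqrtmxP[Tpsd TT].
rewrite -SS -TT -tensmx_mul -{1}(psdmx_tr Spsd) -{1}(psdmx_tr Tpsd) -trmx_tens.
exact: psdmx_gram.
Qed.

Lemma psdmx_antisym {R : realType} {n} {M : 'M[R]_n} :
  psdmx M -> psdmx (- M) -> M = 0.
Proof.
move=> Mpsd NMpsd; apply/matrixP => i j; rewrite [RHS]mxE.
have : M *m delta_mx j (0 : 'I_1) = 0; last first.
  by move/matrixP/(_ i 0); rewrite -colE !mxE.
apply: psdmx_congr_eq0 => //; apply/matrixP => a b; rewrite !ord1 [RHS]mxE.
apply/eqP; rewrite eq_le (Mpsd.2 (delta_mx j 0)) andbT -oppr_ge0.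
by have := NMpsd.2 (delta_mx j 0); rewrite mulmxN mulNmx mxE.
Qed.

(* As 0^-1 = 0, inverting the diagonal of a diagonalization entrywise gives the
   Moore-Penrose inverse. *)
Lemma moore_penroseP {R : realType} {n} {M : 'M[R]_n} :
  M^T = M -> let P := moore_penrose M in
  [/\ M *m P *m M = M, P *m M *m P = P,
      (M *m P)^T = M *m P & (P *m M)^T = P *m M].
Proof.
move=> Msym.
suff : [/\ M *m moore_penrose M *m M = M,
    moore_penrose M *m M *m moore_penrose M = moore_penrose M,
    M *m moore_penrose M \is symmetricmx
    & moore_penrose M *m M \is symmetricmx].
  by case=> ? ? /symmetricmxP ? /symmetricmxP ?.
apply: (xgetPex 0 (P := [set P | [/\ M *m P *m M = M, P *m M *m P = P,
  M *m P \is symmetricmx & P *m M \is symmetricmx]]%classic)).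
have [U [D [UU UU' MD]]] := real_symmetric_diagonalization Msym.
pose E := map_mx GRing.inv D.
pose conjU (B : 'rV[R]_n) := U^T *m diag_mx B *m U.
have conjM B C : conjU B *m conjU C = conjU (\row_i (B 0 i * C 0 i)).
  rewrite /conjU !mulmxA -(mulmxA _ U) UU mulmx1 -(mulmxA U^T) mulmx_diag.
  by congr (_ *m diag_mx _ *m _); apply/rowP => i; rewrite !mxE.
have conj_sym B : conjU B \is symmetricmx.
  by apply/symmetricmxP; rewrite /conjU !trmx_mul trmxK tr_diag_mx mulmxA.
have {}MD : M = conjU D by [].
exists (conjU E) => /=; rewrite MD !conjM; split => //.
- congr conjU; apply/rowP => i; rewrite !mxE.
  by have [->|D0] := eqVneq (D 0 i) 0; rewrite ?mulr0 ?mulfV ?mul1r.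
- congr conjU; apply/rowP => i; rewrite !mxE.
  by have [->|D0] := eqVneq (D 0 i) 0; rewrite ?invr0 ?mulr0 ?mulVf ?mul1r.
Qed.

(** Once [P] is symmetric, [P = P *m M *m P] is a congruence of [M]. As [M] is symmetric, [P^T]
    satisfies the same four equations; the computation is the uniqueness proof of the pseudoinverse
    applied to [P] and [P^T]. *)
Lemma psdmx_moore_penrose {R : realType} {n} {M : 'M[R]_n} :
  psdmx M -> psdmx (moore_penrose M).
Proof.
move=> Mpsd; have Msym := psdmx_tr Mpsd.
have [] := moore_penroseP Msym; set P := moore_penrose M => MPM PMP MPsym PMsym.
have QM : P^T *m M = M *m P by rewrite -MPsym trmx_mul Msym.
have MQ : M *m P^T = P *m M by rewrite -PMsym trmx_mul Msym.
have MQM : M *m P^T *m M = M.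
  by rewrite -{3}Msym -{3}MPM !trmx_mul Msym mulmxA.
have MQsym : (M *m P^T)^T = M *m P^T by rewrite MQ.
have MPMQ : M *m P = M *m P^T.
  rewrite -MPsym -{1}MQM -mulmxA trmx_mul MPsym MQsym mulmxA.
  by rewrite MPM.
have QMQ : P^T *m M *m P^T = P^T by rewrite -{3}PMP !trmx_mul Msym mulmxA.
have Psym : P^T = P.
  by rewrite -QMQ QM MPMQ -{3}PMP -(mulmxA P) MPMQ mulmxA -MQ.
by rewrite -PMP -{1}Psym; exact: psdmx_congr.
Qed.

Lemma pdmxP {R : realType} {n} {M : 'M[R]_n} :
  pdmx M <-> psdmx M /\ M \in unitmx.
Proof.
split=> [[Msym Mpos]|[Mpsd Munit]].
  split; first split=> // v.
    by have [->|/Mpos/ltW//] := eqVneq v 0; rewrite mulmx0 mxE.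
  rewrite -row_free_unit -kermx_eq0; apply/eqP/row_matrixP => i; rewrite row0.
  set u := row i _.
  have uM : u *m M = 0 by apply/sub_kermxP; exact: row_sub.
  apply/eqP; apply: contraT => uN0; have := Mpos u^T.
  by rewrite trmxK uM mul0mx mxE ltxx trmx_eq0 uN0 => /(_ isT).
split=> [|v vN0]; first exact: Mpsd.1.
rewrite lt_neqAle Mpsd.2 andbT eq_sym; apply: contra vN0 => /eqP vMv.
have /(psdmx_congr_eq0 Mpsd) Mv : v^T *m M *m v = 0.
  by apply/matrixP => i j; rewrite !ord1 vMv mxE.
by rewrite -[v](mulKmx Munit) Mv mulmx0.
Qed.

Lemma sqrt_invmxP {R : realType} {n} {M : 'M[R]_n} :
  pdmx M -> let S := psd_sqrtmx (invmx M) in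
  [/\ S^T = S, S \in unitmx & S *m M *m S = 1%:M].
Proof.
move=> /pdmxP[Mpsd Munit] S.
have /psd_sqrtmxP[] : psdmx (invmx M).
  have -> : invmx M = (invmx M)^T *m M *m invmx M.
    by rewrite mulmxK // trmx_inv (psdmx_tr Mpsd).
  exact: psdmx_congr.
rewrite -/S => Spsd SS.
have Sunit : S \in unitmx.
  have : S *m S \in unitmx by rewrite SS unitmx_inv.
  by rewrite unitmx_mul => /andP[].
split=> //; first exact: psdmx_tr.
(* Multiplying by [S] and its inverse on the right creates [S *m S], which is the inverse of [M]. *)
by rewrite -[LHS](mulmxK Sunit) -(mulmxA (S *m M)) SS mulmxK // mulmxV.
Qed.

(** * Tuples, pencils and homogeneous free spectrahedra *)

Lemma symtupleP {R : realType} {k n} {X : mxtuple R k n} :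
  symtuple X <-> forall i, (X i)^T = X i.
Proof. by split=> X_sym i; apply/symmetricmxP. Qed.

Lemma symtuple_congr {R : realType} {k m n} {X : mxtuple R k m}
    (W : 'M[R]_(m, n)) :
  symtuple X -> symtuple (tuple_mul W^T X W).
Proof.
move=> /symtupleP Xsym; apply/symtupleP => i.
by rewrite /tuple_mul !trmx_mul trmxK Xsym mulmxA.
Qed.

Lemma tuple_mulA {R : realType} {k m n p} (V : 'M[R]_(p, m)) (W : 'M[R]_(m, n))
    (X : mxtuple R k n) (W' : 'M[R]_(n, m)) (V' : 'M[R]_(m, p)) :
  tuple_mul V (tuple_mul W X W') V' = tuple_mul (V *m W) X (W' *m V').
Proof. by apply/funext => i; rewrite /tuple_mul !mulmxA. Qed.

Lemma tuple_mul1 {R : realType} {k n} (X : mxtuple R k n) :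
  tuple_mul 1%:M X 1%:M = X.
Proof. by apply/funext => i; rewrite /tuple_mul mul1mx mulmx1. Qed.

Lemma tuple_cons0 {R : realType} {g n} (X0 : 'M[R]_n) (X : mxtuple R g n) :
  tuple_cons X0 X ord0 = X0.
Proof. by rewrite /tuple_cons unlift_none. Qed.

Lemma tuple_consS {R : realType} {g n} (X0 : 'M[R]_n) (X : mxtuple R g n) j :
  tuple_cons X0 X (lift ord0 j) = X j.
Proof. by rewrite /tuple_cons liftK. Qed.

Lemma tuple_consK {R : realType} {g n} (X : mxtuple R g.+1 n) :
  tuple_cons (X ord0) (fun j => X (lift ord0 j)) = X.
Proof.
by apply/funext => i; case: (unliftP ord0 i) => [j|] ->;
  rewrite ?tuple_cons0 ?tuple_consS.
Qed.

Lemma tuple_cons_inj {R : realType} {g n} {X0 Y0 : 'M[R]_n}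
    {X Y : mxtuple R g n} :
  tuple_cons X0 X = tuple_cons Y0 Y -> X0 = Y0 /\ X = Y.
Proof.
move=> XY; split; first by rewrite -(tuple_cons0 X0 X) XY tuple_cons0.
by apply/funext => j; rewrite -(tuple_consS X0 X) XY tuple_consS.
Qed.

Lemma tuple_mul_cons {R : realType} {g m n} (V : 'M[R]_(m, n)) (X0 : 'M[R]_n)
    (X : mxtuple R g n) (W : 'M[R]_(n, m)) :
  tuple_mul V (tuple_cons X0 X) W = tuple_cons (V *m X0 *m W) (tuple_mul V X W).
Proof.
by rewrite -[LHS]tuple_consK /tuple_mul tuple_cons0; congr tuple_cons;
  apply/funext => j; rewrite tuple_consS.
Qed.

Lemma symtuple_cons {R : realType} {g n} {X0 : 'M[R]_n} {X : mxtuple R g n} :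
  symtuple (tuple_cons X0 X) <-> X0^T = X0 /\ symtuple X.
Proof.
split=> [Xsym|[X0sym Xsym] i].
  split=> [|j]; first by have /symmetricmxP := Xsym ord0; rewrite tuple_cons0.
  by have := Xsym (lift ord0 j); rewrite tuple_consS.
by case: (unliftP ord0 i) => [j|] ->; rewrite ?tuple_cons0 ?tuple_consS //;
  apply/symmetricmxP.
Qed.

Lemma hom_pencil_mul {R : realType} {k d e n m} (A : mxtuple R k d)
    (X : mxtuple R k n) (V : 'M[R]_(e, d)) (V' : 'M[R]_(d, e))
    (W : 'M[R]_(m, n)) (W' : 'M[R]_(n, m)) :
  hom_pencil (tuple_mul V A V') (tuple_mul W X W') =
  (V *t W) *m hom_pencil A X *m (V' *t W').
Proof.
rewrite /hom_pencil mulmx_sumr mulmx_suml; apply: eq_bigr => i _.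
by rewrite /tuple_mul !tensmx_mul.
Qed.

Lemma hom_pencil_cons {R : realType} {g d n} (A0 : 'M[R]_d) (A : mxtuple R g d)
    (X0 : 'M[R]_n) (X : mxtuple R g n) :
  hom_pencil (tuple_cons A0 A) (tuple_cons X0 X) =
  A0 *t X0 + \sum_(i < g) (A i *t X i).
Proof.
rewrite /hom_pencil big_ord_recl !tuple_cons0; congr (_ + _).
by apply: eq_bigr => j _; rewrite !tuple_consS.
Qed.

Lemma tensmxDr {R : realType} {m n p q} (A : 'M[R]_(m, n)) (B C : 'M[R]_(p, q)) :
  A *t (B + C) = A *t B + A *t C.
Proof. by apply/matrixP => i j; rewrite !mxE mulrDr. Qed.

Lemma tensmxZr {R : realType} {m n p q} a (A : 'M[R]_(m, n))
    (B : 'M[R]_(p, q)) :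
  A *t (a *: B) = a *: (A *t B).
Proof. by apply/matrixP => i j; rewrite !mxE mulrCA. Qed.

Lemma tensmxZl {R : realType} {m n p q} a (A : 'M[R]_(m, n))
    (B : 'M[R]_(p, q)) :
  (a *: A) *t B = a *: (A *t B).
Proof. by apply/matrixP => i j; rewrite !mxE mulrA. Qed.

Lemma hfs_congr {R : realType} {k d n m} {A : mxtuple R k d}
    {X : mxtuple R k n} (W : 'M[R]_(n, m)) :
  hom_free_spectrahedron A X -> hom_free_spectrahedron A (tuple_mul W^T X W).
Proof.
move=> [Xsym Xpsd]; split; first exact: symtuple_congr.
rewrite -(tuple_mul1 A) hom_pencil_mul -{1}trmx1 -trmx_tens.
exact: psdmx_congr.
Qed.

Lemma hfs_congr_coeff {R : realType} {k d e n} {A : mxtuple R k d}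
    {X : mxtuple R k n} (V : 'M[R]_(d, e)) :
  hom_free_spectrahedron A X -> hom_free_spectrahedron (tuple_mul V^T A V) X.
Proof.
move=> [Xsym Xpsd]; split=> //.
rewrite -(tuple_mul1 X) hom_pencil_mul -{1}trmx1 -trmx_tens.
exact: psdmx_congr.
Qed.

(** [V] and [W] may be rectangular, so this covers both a change of basis and the removal of a zero
    summand. *)
Lemma hfs_congr_coeff_eq {R : realType} {k d e} {A : mxtuple R k d}
    {B : mxtuple R k e} (V : 'M[R]_(d, e)) (W : 'M[R]_(e, d)) :
  B = tuple_mul V^T A V -> A = tuple_mul W^T B W ->
  hom_free_spectrahedron A = hom_free_spectrahedron B.
Proof.
move=> BE AE; apply: functional_extensionality_dep => n; apply/seteqP; split=> X AX.
  by rewrite BE; exact: hfs_congr_coeff.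
by rewrite AE; exact: hfs_congr_coeff.
Qed.

Lemma hfsD {R : realType} {k d n} {A : mxtuple R k d} {X Y : mxtuple R k n} :
  hom_free_spectrahedron A X -> hom_free_spectrahedron A Y ->
  hom_free_spectrahedron A (fun i => X i + Y i).
Proof.
move=> [/symtupleP Xsym Xpsd] [/symtupleP Ysym Ypsd]; split.
  by apply/symtupleP => i; rewrite linearD /= Xsym Ysym.
rewrite /hom_pencil; under eq_bigr do rewrite tensmxDr.
by rewrite big_split; exact: psdmxD.
Qed.

Lemma hfsZ {R : realType} {k d n} {A : mxtuple R k d} {X : mxtuple R k n}
    {a : R} :
  0 <= a -> hom_free_spectrahedron A X ->
  hom_free_spectrahedron A (fun i => a *: X i).
Proof.
move=> a_ge0 [/symtupleP Xsym Xpsd]; split.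
  by apply/symtupleP => i; rewrite linearZ /= Xsym.
rewrite /hom_pencil; under eq_bigr do rewrite tensmxZr.
by rewrite -scaler_sumr; exact: psdmxZ.
Qed.

Lemma hfs_unit {R : realType} {g d} {A0 : 'M[R]_d} {A : mxtuple R g d} n :
  psdmx A0 ->
  hom_free_spectrahedron (tuple_cons A0 A) (tuple_cons (1%:M : 'M[R]_n) (fun=> 0)).
Proof.
move=> A0psd; split.
  by apply/symtuple_cons; rewrite trmx1; split=> // i; apply/symmetricmxP; rewrite trmx0.
rewrite hom_pencil_cons big1 => [|i _]; last exact: tensmx0.
by rewrite addr0; exact/psdmx_tens/psdmx1.
Qed.

(** The size [d * 1] is not convertible to [d], so entries are matched through [mxtens_index]. *)
Lemma tens1_psdmx {R : realType} {d} {M : 'M[R]_d} :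
  psdmx (M *t (1%:M : 'M[R]_1)) -> psdmx M.
Proof.
move=> Mpsd; split.
  apply/symmetricmxP/matrixP => i j.
  have /matrixP/(_ (mxtens_index (i, 0)) (mxtens_index (j, 0))) := psdmx_tr Mpsd.
  by rewrite trmx_tens !tensmxE trmx1 !mxE eqxx !mulr1.
move=> v; have := psdmx_diag_ge0 (mxtens_index (0, 0))
  (psdmx_congr (v *t (1%:M : 'M[R]_1)) Mpsd).
by rewrite trmx_tens trmx1 !tensmx_mul !mulmx1 tensmxE [1%:M 0 0]mxE eqxx mulr1.
Qed.

Lemma free_spectrahedron_dehom {R : realType} {g d} (A : mxtuple R g d) :
  free_spectrahedron A =
  dehomogenization (hom_free_spectrahedron (tuple_cons 1%:M A)).
Proof.
apply: functional_extensionality_dep => n; apply/funext => X.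
rewrite /free_spectrahedron /dehomogenization /hom_free_spectrahedron /=.
rewrite hom_pencil_cons /monic_pencil.
have -> : (1%:M : 'M[R]_d) *t (1%:M : 'M[R]_n) = 1%:M.
  apply/matrixP => i j.
  case: (mxtens_indexP i) => i0 i1; case: (mxtens_indexP j) => j0 j1.
  rewrite tensmxE !mxE (can_eq (mxtens_indexK (n := n))) xpair_eqE.
  by rewrite -natrM mulnb.
apply/propext; split=> -[Xsym Xpsd]; split=> //.
  by apply/symtuple_cons; rewrite trmx1.
by have /symtuple_cons[] := Xsym.
Qed.

(** * Bounded homogeneous free spectrahedra *)

(** The inclusion of the kernel of [X0] in that of each [X i], stated for matrices [V] so that it
    applies directly to blocks such as [1%:M - P *m X0]. *)
Definition kernel_dominated {R : realType} {g n} (X0 : 'M[R]_n)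
    (X : mxtuple R g n) : Prop :=
  forall p (V : 'M[R]_(n, p)), X0 *m V = 0 -> forall i, X i *m V = 0.

Lemma unitmx_kernel_dominated {R : realType} {g n} {X0 : 'M[R]_n}
    (X : mxtuple R g n) :
  X0 \in unitmx -> kernel_dominated X0 X.
Proof. by move=> X0unit p V X0V i; rewrite -[V](mulKmx X0unit) X0V !mulmx0. Qed.

Section BoundedHomogeneous.
Context {R : realType} {g d : nat} {A0 : 'M[R]_d} {A : mxtuple R g d}.
Let H := hom_free_spectrahedron (tuple_cons A0 A).
Hypothesis A0psd : psdmx A0.
Hypothesis Hbounded : hom_bounded H.

(* (0, Y) in H puts the whole ray (I, tY), t >= 0, into H. *)
Lemma hom_bounded_pointed {n} {Y : mxtuple R g n} :
  H _ (tuple_cons 0 Y) -> forall i, Y i = 0.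
Proof.
move=> HY.
have Ysym : symtuple Y by have [/symtuple_cons[]] := HY.
have [C C_gt0 HC] := Hbounded.
(* By symmetry of the [Y i], this is the [j]-th diagonal entry of the sum of their squares, the
   quantity that [C] bounds along the ray after scaling by [t ^+ 2]. *)
pose s j := \sum_i (row j (Y i) *m (row j (Y i))^T) 0 0.
have s_ge0 j : 0 <= s j by rewrite sumr_ge0 // => i _; exact: mulmx_tr_self_ge0.
have ray t : 0 <= t -> H _ (tuple_cons 1%:M (fun i => t *: Y i)).
  move=> t_ge0; have := hfsD (hfs_unit n A0psd) (hfsZ t_ge0 HY).
  rewrite -/H -[X in H _ X]tuple_consK !tuple_cons0 scaler0 addr0.
  congr (H _ (tuple_cons _ _)); apply/funext => i.
  by rewrite !tuple_consS add0r.
have bound t j : 0 <= t -> t ^+ 2 * s j <= C.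
  move=> /ray/HC/(psdmx_diag_ge0 j).
  rewrite !mxE eqxx mulr1n subr_ge0 summxE /s mulr_sumr.
  under eq_bigr => i _ do rewrite -scalemxAl -scalemxAr scalerA -expr2 mxE.
  apply: le_trans; apply: ler_sum => i _; rewrite ler_wpM2l ?sqr_ge0 // !mxE.
  apply: ler_sum => k _; rewrite !mxE.
  by have /symtupleP/(_ i)/matrixP/(_ j k) := Ysym; rewrite mxE => ->.
have s0 j : s j = 0.
  apply/eqP; apply: contraT => sN0.
  have s_gt0 : 0 < s j by rewrite lt_neqAle eq_sym sN0 s_ge0.
  (* This [t] makes [t ^+ 2 * s j] equal to [C + 1], beyond the bound. *)
  have := bound (Num.sqrt ((C + 1) / s j)) j (sqrtr_ge0 _).
  rewrite sqr_sqrtr ?divr_ge0 ?addr_ge0 ?(ltW C_gt0) // divfK //.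
  by rewrite gerDl ler10.
move=> i; apply/row_matrixP => j; rewrite row0; apply/eqP.
rewrite -mulmx_tr_self_eq0.
have /eqP := s0 j; rewrite psumr_eq0 => [/allP|k _]; last exact: mulmx_tr_self_ge0.
by apply; rewrite mem_index_enum.
Qed.

Hypothesis A0ker : kernel_dominated A0 A.
Hypothesis g_gt0 : (0 < g)%N.

(** Suppose [v] gives a negative value [a]. Compressing by [v] yields (a, x) in H, and adding [- a]
    times (1, 0) yields (0, x), so x = 0 by pointedness. Then (a, 0) in H forces [A0 = 0], hence all
    [A i = 0]. So H contains (0, 1, ..., 1), which contradicts pointedness because g is positive. *)
Lemma hom_bounded_psd {n} {X0 : 'M[R]_n} {X : mxtuple R g n} :
  H _ (tuple_cons X0 X) -> psdmx X0.
Proof.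
move=> HX; have [/symtuple_cons[X0sym _] _] := HX.
split=> [|v]; first exact/symmetricmxP.
rewrite leNgt; apply/negP => a_lt0; set a := (_ 0 0) in a_lt0.
have := hfs_congr v HX; rewrite tuple_mul_cons [v^T *m _ *m v]mx11_scalar -/a.
set x := tuple_mul _ _ _ => Hx.
have Na_ge0 : 0 <= - a by rewrite oppr_ge0 ltW.
have x0 : x = fun=> 0.
  apply/funext => i; apply: hom_bounded_pointed i.
  have := hfsD Hx (hfsZ Na_ge0 (hfs_unit 1 A0psd)).
  rewrite -/H -[X in H _ X]tuple_consK !tuple_cons0 -scalemx1 -scalerDl subrr.
  rewrite scale0r; congr (H _ (tuple_cons _ _)); apply/funext => i.
  by rewrite !tuple_consS scaler0 addr0.
have A00 : A0 = 0.
  apply: psdmx_antisym => //.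
  have [_] := Hx; rewrite x0 hom_pencil_cons big1; last by move=> *; exact: tensmx0.
  have aV_ge0 : 0 <= - a^-1 by rewrite oppr_ge0 invr_le0 ltW.
  rewrite addr0 -scalemx1 tensmxZr -tensmxZl => /tens1_psdmx/(psdmxZ aV_ge0).
  by rewrite scalerA mulNr mulVf ?scaleN1r // lt_eqF.
have AE i : A i = 0 by rewrite -[LHS]mulmx1; apply: A0ker; rewrite A00 mul0mx.
have /(hom_bounded_pointed)/(_ (Ordinal g_gt0))/matrixP/(_ 0 0) :
    H _ (tuple_cons 0 (fun=> 1%:M : 'M[R]_1)).
  split; first by apply/symtuple_cons; rewrite trmx0; split=> // i;
    apply/symmetricmxP; rewrite trmx1.
  rewrite hom_pencil_cons tensmx0 add0r big1 => [|i _]; first exact: psdmx0.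
  by rewrite AE tens0mx.
by rewrite !mxE eqxx => /eqP; rewrite oner_eq0.
Qed.

(** Compression by [V] gives (0, V^T X V) in H, so [V^T *m X i *m V = 0]. This is weaker than the
    goal; it makes the form of the pencil vanish on [1%:M *t V], so the pencil itself kills
    [1%:M *t V]. *)
Lemma hom_bounded_kernel {n} {X0 : 'M[R]_n} {X : mxtuple R g n} :
  H _ (tuple_cons X0 X) -> kernel_dominated X0 X.
Proof.
move=> HX p V X0V.
have [_ Xpsd] := HX.
have VXV i : tuple_mul V^T X V i = 0.
  apply: hom_bounded_pointed i; have := hfs_congr V HX.
  by rewrite tuple_mul_cons -mulmxA X0V mulmx0.
have LV : hom_pencil (tuple_cons A0 A) (tuple_cons X0 X) *m (1%:M *t V) = 0.
  apply: psdmx_congr_eq0 => //; rewrite trmx_tens trmx1 -hom_pencil_mul.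
  rewrite tuple_mul1 tuple_mul_cons -mulmxA X0V mulmx0 hom_pencil_cons tensmx0.
  by rewrite add0r big1 // => i _; rewrite VXV tensmx0.
move=> i; apply/matrixP => j k; rewrite [RHS]mxE.
pose e : 'rV[R]_n := delta_mx 0 j; pose f : 'cV[R]_p := delta_mx k 0.
(* The numbers [e *m X i *m V *m f] do not come from a congruence, as the left and right factors
   differ. They still form a member of H with first entry 0, because [LV] makes their pencil
   zero. *)
have /(_ i)/matrixP/(_ 0 0) : forall i, tuple_mul e X (V *m f) i = 0.
  apply: hom_bounded_pointed; split.
    apply/symtuple_cons; rewrite trmx0; split=> // l; apply/symmetricmxP.
    by apply/matrixP => a b; rewrite !ord1 mxE.
  have -> : (0 : 'M[R]_1) = e *m X0 *m (V *m f).
    by rewrite -mulmxA (mulmxA X0) X0V mul0mx mulmx0.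
  rewrite -tuple_mul_cons -[tuple_cons A0 A]tuple_mul1 hom_pencil_mul.
  have -> : (1%:M : 'M[R]_d) *t (V *m f) = (1%:M *t V) *m (1%:M *t f).
    by rewrite tensmx_mul mulmx1.
  rewrite -mulmxA (mulmxA (hom_pencil _ _)) LV mul0mx mulmx0; exact: psdmx0.
by rewrite /tuple_mul -rowE mulmxA -row_mul -colE !mxE => ->.
Qed.

(** Compressing by [S] replaces [X0] by the orthogonal projection [Q = S *m X0 *m S] rather than by
    I. The missing part [A0 *t (1%:M - Q)] is positive semidefinite and can be added. *)
Lemma hom_to_dehom {n} {X0 : 'M[R]_n} {X : mxtuple R g n} :
  let S := psd_sqrtmx (moore_penrose X0) in
  H _ (tuple_cons X0 X) -> dehomogenization H (tuple_mul S X S).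
Proof.
move=> S HX; have X0psd := hom_bounded_psd HX.
have [Spsd SS] := psd_sqrtmxP (psdmx_moore_penrose X0psd).
rewrite -/S in Spsd SS.
have [X0PX0 _ _ _] := moore_penroseP (psdmx_tr X0psd).
have HS := hfs_congr S HX; rewrite (psdmx_tr Spsd) tuple_mul_cons in HS.
case: HS => /symtuple_cons[Qsym SXSsym] HS.
split; first by apply/symtuple_cons; rewrite trmx1.
set Q := S *m X0 *m S in Qsym HS.
have QQ : Q *m Q = Q.
  by rewrite /Q !mulmxA -(mulmxA _ S S) SS -(mulmxA S) -(mulmxA S) X0PX0.
have -> : hom_pencil (tuple_cons A0 A) (tuple_cons 1%:M (tuple_mul S X S)) =
    A0 *t (1%:M - Q) + hom_pencil (tuple_cons A0 A) (tuple_cons Q (tuple_mul S X S)).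
  by rewrite !hom_pencil_cons addrA -tensmxDr subrK.
apply: psdmxD => //; apply: psdmx_tens => //.
have -> : 1%:M - Q = (1%:M - Q)^T *m (1%:M - Q); last exact: psdmx_gram.
have -> : (1%:M - Q)^T = 1%:M - Q by rewrite linearB /= trmx1 Qsym.
by rewrite mulmxBl mul1mx mulmxBr mulmx1 QQ subrr subr0.
Qed.

End BoundedHomogeneous.

(** Compression by [S *m X0] sends I to [X0 *m P *m X0 = X0] and the given tuple to the tuple of the
    [X0 *m P *m X i *m P *m X0]. These equal [X i], since [1%:M - P *m X0] maps into the kernel of
    [X0] and hence into that of [X i]. *)
Lemma hom_of_dehom {R : realType} {g d n} {A0 : 'M[R]_d} {A : mxtuple R g d}
    {X0 : 'M[R]_n} {X : mxtuple R g n} :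
  let H := hom_free_spectrahedron (tuple_cons A0 A) in
  let S := psd_sqrtmx (moore_penrose X0) in
  psdmx X0 -> symtuple X -> kernel_dominated X0 X ->
  dehomogenization H (tuple_mul S X S) -> H n (tuple_cons X0 X).
Proof.
move=> H S X0psd /symtupleP Xsym X0ker.
have [Spsd SS] := psd_sqrtmxP (psdmx_moore_penrose X0psd).
rewrite -/S in Spsd SS; have X0sym := psdmx_tr X0psd.
have [X0PX0 _ X0Psym _] := moore_penroseP X0sym.
move=> /(hfs_congr (S *m X0)).
rewrite trmx_mul X0sym (psdmx_tr Spsd) tuple_mul_cons mulmx1 mulmxA -(mulmxA X0).
rewrite SS X0PX0 tuple_mulA -(mulmxA X0) (mulmxA S) SS.
set P := moore_penrose X0 in X0PX0 X0Psym *.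
have XPX0 i : X i *m (P *m X0) = X i.
  apply/eqP; rewrite -subr_eq0 -[X in _ - X]mulmx1 -mulmxBr; apply/eqP.
  by apply: X0ker; rewrite mulmxBr mulmx1 mulmxA X0PX0 subrr.
have -> // : tuple_mul (X0 *m P) X (P *m X0) = X.
apply/funext => i; rewrite /tuple_mul -mulmxA XPX0.
have Psym := psdmx_tr (psdmx_moore_penrose X0psd).
by rewrite -[RHS]Xsym -[in RHS]XPX0 !trmx_mul X0sym Psym Xsym.
Qed.

Lemma hom_eq_of_dehom_eq {R : realType} {g d e} {A0 : 'M[R]_d}
    {A : mxtuple R g d} {B0 : 'M[R]_e} {B : mxtuple R g e} :
  let HA := hom_free_spectrahedron (tuple_cons A0 A) in
  let HB := hom_free_spectrahedron (tuple_cons B0 B) in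
  (0 < g)%N -> hom_bounded HA ->
  psdmx A0 -> kernel_dominated A0 A -> psdmx B0 -> kernel_dominated B0 B ->
  dehomogenization HA = dehomogenization HB -> HA = HB.
Proof.
move=> HA HB g_gt0 HAb A0psd A0ker B0psd B0ker AB.
(* Boundedness depends on the dehomogenization only, so it passes from [HA] to [HB]. *)
have HBb : hom_bounded HB by rewrite /hom_bounded -AB.
apply: functional_extensionality_dep => n; apply/seteqP; split=> X;
  rewrite -[X]tuple_consK => HX; have [/symtuple_cons[_ Xsym] _] := HX.
- apply: hom_of_dehom => //.
  + exact: hom_bounded_psd HX.
  + exact: hom_bounded_kernel HX.
  + by rewrite -/HB -AB; exact: hom_to_dehom HX.
- apply: hom_of_dehom => //.
  + exact: hom_bounded_psd HX.
  + exact: hom_bounded_kernel HX.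
  + by rewrite -/HA AB; exact: hom_to_dehom HX.
Qed.

(** * Positivity at the first level *)

Lemma hom_pencil_scalar {R : realType} {k d} (A : mxtuple R k d) (x : 'I_k -> R) :
  hom_pencil A (fun i => (x i)%:M : 'M[R]_1) =
  (\sum_i x i *: A i) *t (1%:M : 'M[R]_1).
Proof.
transitivity (\sum_i (x i *: A i) *t (1%:M : 'M[R]_1)).
  by apply: eq_bigr => i _; rewrite -(scalemx1 _ (x i)) tensmxZr tensmxZl.
apply/matrixP => a b; rewrite [RHS]mxE !summxE mulr_suml.
by apply: eq_bigr => i _; rewrite [LHS]mxE.
Qed.

(** If [A0 *m V = 0], compressing [A0 + t *: A j] and [A0 - t *: A j] by [V] gives opposite positive
    semidefinite matrices, so both vanish; then [A0 + t *: A j] kills [V], and so does [A j]. *)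
Lemma positive_regular {R : realType} {g d} {A0 : 'M[R]_d} {A : mxtuple R g d} :
  positive_free_set (hom_free_spectrahedron (tuple_cons A0 A)) ->
  psdmx A0 /\ kernel_dominated A0 A.
Proof.
rewrite /positive_free_set /interior => posH.
have psdE (x : 'rV[R]_g.+1) :
    hom_free_spectrahedron (tuple_cons A0 A) (fun i => (x 0 i)%:M : 'M[R]_1) ->
    psdmx (x 0 ord0 *: A0 + \sum_(i < g) x 0 (lift ord0 i) *: A i).
  move=> [_]; rewrite hom_pencil_scalar => /tens1_psdmx.
  rewrite big_ord_recl tuple_cons0; congr (psdmx (_ + _)).
  by apply: eq_bigr => i _; rewrite tuple_consS.
have A0psd : psdmx A0.
  have /psdE := nbhs_singleton posH.
  rewrite mxE !eqxx scale1r big1 ?addr0 // => i _.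
  by rewrite mxE scale0r.
split=> // p V A0V j.
have [e e_gt0 He] : exists2 e : R, 0 < e &
    forall t, `|t| < e -> psdmx (A0 + t *: A j).
  have [e /= e_gt0 He] := (nbhs_ballP _ _).1 posH.
  exists e => // t t_lt.
  have /He/psdE : ball (delta_mx 0 0 : 'rV[R]_g.+1) e
      (delta_mx 0 0 + t *: delta_mx 0 (lift ord0 j)).
    rewrite /ball /=; split=> // a b; rewrite !mxE !ord1 /=.
    rewrite /ball /= opprD addNKr normrN normrM.
    apply: le_lt_trans t_lt; rewrite ler_piMr //.
    by case: (b == _); rewrite ?normr1 ?normr0.
  rewrite !mxE !eqxx /= mulr0 addr0 scale1r (bigD1 j) //= !mxE !eqxx /=.
  rewrite add0r mulr1 big1 ?addr0 // => i ij.
  rewrite !mxE /= (inj_eq lift_inj) (negbTE ij) mulr0 addr0; exact: scale0r.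
pose t := e / 2; have t_gt0 : 0 < t by rewrite divr_gt0.
have t_lt : `|t| < e by rewrite gtr0_norm // /t; lra.
have Apsd := He t t_lt.
have NApsd : psdmx (A0 - t *: A j) by rewrite -scaleNr; apply: He; rewrite normrN.
have quad s : V^T *m (A0 + s *: A j) *m V = s *: (V^T *m A j *m V).
  by rewrite mulmxDr mulmxDl -mulmxA A0V mulmx0 add0r -scalemxAr -scalemxAl.
have /(psdmx_congr_eq0 Apsd) : V^T *m (A0 + t *: A j) *m V = 0.
  apply: psdmx_antisym; first exact: psdmx_congr.
  by have := psdmx_congr V NApsd; rewrite -scaleNr !quad scaleNr.
rewrite mulmxDl A0V add0r -scalemxAl => /eqP.
by rewrite scaler_eq0 gt_eqF //= => /eqP.
Qed.

(** A crude bound from [v_i v_j] being at most the squared norm of [v] in absolute value; it yields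
    an explicit radius in [monic_positive]. *)
Lemma quad_form_bound {R : realType} {n} (M : 'M[R]_n) (v : 'cV[R]_n) :
  `|(v^T *m M *m v) 0 0| <= (\sum_i \sum_j `|M i j|) * (v^T *m v) 0 0.
Proof.
have vv : (v^T *m v) 0 0 = \sum_i v i 0 ^+ 2.
  by rewrite mxE; apply: eq_bigr => i _; rewrite mxE expr2.
have vi_le i : v i 0 ^+ 2 <= (v^T *m v) 0 0.
  by rewrite vv (bigD1 i) //= lerDl sumr_ge0 // => j _; exact: sqr_ge0.
have vij_le i j : `|v i 0 * v j 0| <= (v^T *m v) 0 0.
  have := vi_le i; have := vi_le j; rewrite normrM.
  rewrite -[v i 0 ^+ 2]real_normK ?num_real // -[v j 0 ^+ 2]real_normK ?num_real //.
  move: `|v i 0| `|v j 0| (_ 0 0) => a b s; nra.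
move: ((v^T *m v) 0 0) vij_le => s vij_le.
rewrite mxE [X in _ <= X * _]exchange_big mulr_suml.
apply: le_trans (ler_norm_sum _ _ _) _; apply: ler_sum => j _.
rewrite mxE !mulr_suml; apply: le_trans (ler_norm_sum _ _ _) _.
by apply: ler_sum => i _; rewrite mxE mulrAC mulrC normrM ler_wpM2l.
Qed.

Lemma monic_positive {R : realType} {g d} {A : mxtuple R g d} :
  symtuple A ->
  positive_free_set (hom_free_spectrahedron (tuple_cons 1%:M A)).
Proof.
move=> Asym.
have Csym : symtuple (tuple_cons 1%:M A) by apply/symtuple_cons; rewrite trmx1.
set C := tuple_cons 1%:M A in Csym *.
pose K := \sum_k \sum_i \sum_j `|C k i j|.
have K_ge0 : 0 <= K.
  by rewrite !sumr_ge0 // => k _; rewrite !sumr_ge0 // => i _; rewrite sumr_ge0.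
rewrite /positive_free_set /interior; apply/nbhs_ballP.
(* On this ball the perturbation of the identity has a form of size at most K / (1 + K) times the
   squared norm of [v]. The summand 1 keeps the denominator positive even for [d = 0], where
   [K = 0]. *)
exists (1 + K)^-1 => [|x xball] /=; first by rewrite invr_gt0; lra.
split=> [i|]; first by apply/symmetricmxP; rewrite tr_scalar_mx.
rewrite hom_pencil_scalar; apply: psdmx_tens psdmx1.
split=> [|v].
  apply/symmetricmxP; rewrite linear_sum; apply: eq_bigr => i _ /=.
  by rewrite linearZ /=; congr (_ *: _); apply/symmetricmxP.
pose e i := x 0 i - (delta_mx 0 0 : 'rV[R]_g.+1) 0 i.
have e_le i : `|e i| <= (1 + K)^-1.
  by rewrite /e distrC; exact/ltW/(xball.2 0 i).
have -> : \sum_i x 0 i *: C i = 1%:M + \sum_i e i *: C i.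
  have -> : (1%:M : 'M[R]_d) = \sum_i (delta_mx 0 0 : 'rV[R]_g.+1) 0 i *: C i.
    rewrite big_ord_recl big1 => [|i _]; last by rewrite mxE scale0r.
    by rewrite mxE !eqxx scale1r addr0 /C tuple_cons0.
  rewrite -big_split; apply: eq_bigr => i _ /=.
  by rewrite -scalerDl /e addrC subrK.
rewrite mulmxDr mulmxDl mulmx1 mxE mulmx_sumr mulmx_suml summxE.
set s := (v^T *m v) 0 0.
have s_ge0 : 0 <= s by have := mulmx_tr_self_ge0 v^T; rewrite trmxK.
rewrite -lerBlDl sub0r lerNl.
have : \sum_i `|e i| * `|(v^T *m C i *m v) 0 0| <= (1 + K)^-1 * (K * s).
  rewrite /K !mulr_suml mulr_sumr; apply: ler_sum => i _.
  by apply: ler_pM => //; exact: quad_form_bound.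
have : (1 + K)^-1 * (K * s) <= s.
  by rewrite mulrC ler_pdivrMr; nra.
move=> h1 h2; apply: le_trans h1; apply: le_trans h2.
rewrite -sumrN; apply: ler_sum => i _.
rewrite -scalemxAr -scalemxAl mxE -normrM -normrN; exact: ler_norm.
Qed.

(** * Splitting off the kernel of the constant coefficient *)

Lemma pdmx_congr {R : realType} {m n} {M : 'M[R]_m} {V : 'M[R]_(m, n)}
    {W : 'M[R]_(n, m)} :
  W *m V = 1%:M -> pdmx M -> pdmx (V^T *m M *m V).
Proof.
move=> WV [Msym Mpos]; split=> [|v vN0].
  apply/symmetricmxP; have /symmetricmxP Mt := Msym.
  by rewrite !trmx_mul trmxK Mt mulmxA.
have VvN0 : V *m v != 0.
  by apply: contra_neq vN0 => Vv; rewrite -[v]mul1mx -WV -mulmxA Vv mulmx0.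
by have := Mpos _ VvN0; rewrite trmx_mul !mulmxA.
Qed.

Lemma pdmx_regular {R : realType} {g n} {M : 'M[R]_n} (X : mxtuple R g n) :
  pdmx M -> psdmx M /\ kernel_dominated M X.
Proof. by move=> /pdmxP[Mpsd Munit]; split=> //; exact: unitmx_kernel_dominated. Qed.

(* In the basis given by the row echelon form of A0 every member of the tuple is
   supported on the first \rank A0 coordinates. *)
Lemma kernel_reduction {R : realType} {g d} {A0 : 'M[R]_d} {A : mxtuple R g d} :
  psdmx A0 -> symtuple A -> kernel_dominated A0 A ->
  let J := pid_mx (\rank A0) : 'M[R]_(d, \rank A0) in
  exists (E : 'M[R]_d) (B0 : 'M[R]_(\rank A0)) (B : mxtuple R g (\rank A0)),
    [/\ E \in unitmx, pdmx B0, symtuple B,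
        tuple_mul E^T (tuple_cons A0 A) E =
        tuple_mul J (tuple_cons B0 B) J^T
      & hom_free_spectrahedron (tuple_cons A0 A) =
        hom_free_spectrahedron (tuple_cons B0 B)].
Proof.
move=> A0psd Asym A0ker; set r := \rank A0 => J.
have r_le : (r <= d)%N := rank_leq_row A0.
have JJ : J^T *m J = 1%:M by rewrite tr_pid_mx pid_mx_id // pid_mx_1.
have JJ' : J *m J^T = pid_mx r by rewrite tr_pid_mx pid_mx_id.
have [E Eunit A0E] : exists2 E : 'M[R]_d, E \in unitmx & A0 *m E *m copid_mx r = 0.
  (* [A0] factors as [col_ebase A0 *m pid_mx r *m row_ebase A0]; cancelling the last factor leaves
     columns that vanish beyond the [r]-th. *)
  exists (invmx (row_ebase A0)); first by rewrite unitmx_inv row_ebase_unit.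
  rewrite -{1}(mulmx_ebase A0) mulmxK ?row_ebase_unit //.
  by rewrite -mulmxA mul_pid_mx_copid // mulmx0.
have supportE (N : 'M[R]_d) : N^T = N -> N *m copid_mx r = 0 ->
    N = J *m (J^T *m N *m J) *m J^T.
  move=> Nsym Nr.
  have Npid : N *m pid_mx r = N.
    apply/eqP; rewrite eq_sym -subr_eq0 -[X in X - _]mulmx1 -mulmxBr.
    by rewrite -/(copid_mx r) Nr.
  have pidN : pid_mx r *m N = N.
    by rewrite -[RHS]Nsym -[in RHS]Npid trmx_mul tr_pid_mx Nsym.
  by rewrite !mulmxA JJ' pidN -mulmxA JJ' Npid.
pose N (M : 'M[R]_d) := E^T *m M *m E.
have NE (M : 'M[R]_d) : M^T = M -> M *m E *m copid_mx r = 0 ->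
    N M = J *m (J^T *m N M *m J) *m J^T.
  move=> Msym ME; apply: supportE; first by rewrite /N !trmx_mul trmxK Msym mulmxA.
  by rewrite /N -!mulmxA (mulmxA M) ME mulmx0.
have A0sym := psdmx_tr A0psd; have /symtupleP At := Asym.
pose V := E *m J.
have VE (M : 'M[R]_d) : V^T *m M *m V = J^T *m N M *m J.
  by rewrite /V /N trmx_mul !mulmxA.
have EAE : tuple_mul E^T (tuple_cons A0 A) E =
    tuple_mul J (tuple_cons (V^T *m A0 *m V) (tuple_mul V^T A V)) J^T.
  rewrite !tuple_mul_cons -/(N A0) VE -(NE _ A0sym A0E); congr tuple_cons.
  apply/funext => i; rewrite /tuple_mul VE -NE //.
  by rewrite -mulmxA; apply: A0ker; rewrite mulmxA.
exists E, (V^T *m A0 *m V), (tuple_mul V^T A V); split=> //.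
- apply/pdmxP; split; first exact: psdmx_congr.
  (* [N A0] has rank [r] and factors through this [r] by [r] block, which therefore has full
     rank. *)
  rewrite VE -row_free_unit /row_free eqn_leq rank_leq_row /= -/r.
  have rN : \rank (N A0) = r.
    rewrite /N mxrankMfree ?row_free_unit // eqmxMfull //.
    by rewrite row_full_unit unitmx_tr.
  apply: (@leq_trans (\rank (N A0))); first by rewrite rN.
  rewrite {1}(NE _ A0sym A0E).
  exact: leq_trans (mxrankM_maxl _ _) (mxrankM_maxr _ _).
- exact: symtuple_congr.
- apply: (hfs_congr_coeff_eq V (J^T *m invmx E)); first by rewrite tuple_mul_cons.
  rewrite trmx_mul trmxK -tuple_mulA -EAE tuple_mulA mulmxV //.
  by rewrite trmx_inv mulVmx ?unitmx_tr // tuple_mul1.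
Qed.

(** If [A0] were singular, [kernel_reduction] would make the tuple congruent to the direct sum of a
    smaller defining tuple and a zero block. *)
Lemma hom_minimal_pdmx {R : realType} {g d} {A0 : 'M[R]_d} {A : mxtuple R g d}
    {H : free_set R g.+1} :
  psdmx A0 -> symtuple A -> kernel_dominated A0 A ->
  hom_minimal_defining (tuple_cons A0 A) H -> pdmx A0.
Proof.
move=> A0psd Asym A0ker [HA Amin].
have [E [B0 [B [Eunit B0pd Bsym EAE AB]]]] := kernel_reduction A0psd Asym A0ker.
apply/pdmxP; split=> //; rewrite -row_free_unit /row_free eqn_leq rank_leq_row.
rewrite leqNgt; apply/negP => r_lt.
move: E B0 B Eunit B0pd Bsym EAE AB r_lt.
set r := \rank A0 => E B0 B Eunit B0pd Bsym EAE AB r_lt.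
have rd : (r + (d - r))%N = d by rewrite subnKC // ltnW.
case: (Amin E Eunit r (tuple_cons B0 B)).
  split=> //; exists (d - r)%N, (fun=> 0); left.
  (* [pid_mx d] acts as the identity between the types of size [d] and [r + (d - r)], which are
     equal only propositionally. *)
  exists (pid_mx d); split.
  - by rewrite tr_pid_mx pid_mx_id // -[X in pid_mx X]rd pid_mx_1.
  - by rewrite tr_pid_mx pid_mx_id ?rd // pid_mx_1.
  - have dr : minn d r = r by apply/minn_idPr/ltnW.
    rewrite EAE tuple_mulA !tr_pid_mx !mul_pid_mx (minnC r) dr dr.
    rewrite pid_mx_row pid_mx_col.
    apply/funext => i; rewrite /tuple_mul /tuple_dsum mul_col_mx mul1mx mul0mx.
    by rewrite mul_col_row !mul0mx mulmx1 !mulmx0.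
by rewrite -AB.
Qed.

(** * Splittings and minimal defining tuples *)

Lemma tuple_dsum_cons {R : realType} {g m n} (X0 : 'M[R]_m) (X : mxtuple R g m)
    (Y0 : 'M[R]_n) (Y : mxtuple R g n) :
  tuple_dsum (tuple_cons X0 X) (tuple_cons Y0 Y) =
  tuple_cons (block_mx X0 0 0 Y0) (tuple_dsum X Y).
Proof.
rewrite -[LHS]tuple_consK /tuple_dsum !tuple_cons0; congr tuple_cons.
by apply/funext => j; rewrite !tuple_consS.
Qed.

Lemma tuple_mul_dsum {R : realType} {k m n p q} (V : 'M[R]_(m, p))
    (W : 'M[R]_(n, q)) (X : mxtuple R k p) (Y : mxtuple R k q)
    (V' : 'M[R]_(p, m)) (W' : 'M[R]_(q, n)) :
  tuple_mul (block_mx V 0 0 W) (tuple_dsum X Y) (block_mx V' 0 0 W') =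
  tuple_dsum (tuple_mul V X V') (tuple_mul W Y W').
Proof.
apply/funext => i; rewrite /tuple_mul /tuple_dsum !mulmx_block.
by rewrite !(mulmx0, mul0mx, addr0, add0r).
Qed.

Lemma subpencil_symtuple {R : realType} {k d e} {A : mxtuple R k d}
    {B : mxtuple R k e} :
  symtuple A -> subpencil B A -> symtuple B.
Proof.
move=> Asym [f [C split_A]]; apply/symtupleP => i.
have dsum_sym (m n : nat) (X : mxtuple R k m) (Y : mxtuple R k n) :
    orth_split A X Y -> (X i)^T = X i /\ (Y i)^T = Y i.
  move=> [U [_ _ UAU]].
  have /symtupleP/(_ i) := symtuple_congr U Asym.
  by rewrite UAU /tuple_dsum tr_block_mx => /eq_block_mx[].
by case: split_A => /dsum_sym[].
Qed.

(** Orthogonality of the change of basis is what keeps the constant coefficient equal to I. *)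
Lemma subpencil_homogenize {R : realType} {g d e} {A : mxtuple R g d}
    {B : mxtuple R g e} :
  subpencil B A -> subpencil (tuple_cons 1%:M B) (tuple_cons 1%:M A).
Proof.
move=> [f [C split_A]]; exists f, (tuple_cons 1%:M C).
have split_cons (m n : nat) (X : mxtuple R g m) (Y : mxtuple R g n) :
    orth_split A X Y ->
    orth_split (tuple_cons 1%:M A) (tuple_cons 1%:M X) (tuple_cons 1%:M Y).
  move=> [U [UU UU' UAU]]; exists U; split=> //.
  by rewrite tuple_mul_cons tuple_dsum_cons UAU mulmx1 UU scalar_mx_block.
by case: split_A => /split_cons; [left | right].
Qed.

Lemma hfs_normalize {R : realType} {g d} {A0 : 'M[R]_d} (A : mxtuple R g d) :
  pdmx A0 -> let S := psd_sqrtmx (invmx A0) in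
  hom_free_spectrahedron (tuple_cons A0 A) =
  hom_free_spectrahedron (tuple_cons 1%:M (tuple_mul S A S)).
Proof.
move=> A0pd S; have [Ssym Sunit SAS] := sqrt_invmxP A0pd.
have CE : tuple_cons 1%:M (tuple_mul S A S) = tuple_mul S^T (tuple_cons A0 A) S.
  by rewrite Ssym tuple_mul_cons SAS.
apply: (hfs_congr_coeff_eq S (invmx S) CE).
by rewrite CE tuple_mulA -trmx_mul !mulmxV // trmx1 tuple_mul1.
Qed.

Lemma dehom_normalize {R : realType} {g d} {A0 : 'M[R]_d} (A : mxtuple R g d) :
  pdmx A0 -> let S := psd_sqrtmx (invmx A0) in
  dehomogenization (hom_free_spectrahedron (tuple_cons A0 A)) =
  free_spectrahedron (tuple_mul S A S).
Proof. by move=> A0pd S; rewrite (hfs_normalize A A0pd) free_spectrahedron_dehom. Qed.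

(* Normalizing both blocks of V^T (A0, A) V turns V into A0^{-1/2} U with U
   orthogonal. *)
Lemma orth_split_normalize {R : realType} {g d e f} {A0 : 'M[R]_d}
    {A : mxtuple R g d} {V : 'M[R]_d} {B0 : 'M[R]_e} {B : mxtuple R g e}
    {C0 : 'M[R]_f} {C : mxtuple R g f} :
  pdmx A0 -> V \in unitmx ->
  orth_split (tuple_mul V^T (tuple_cons A0 A) V)
    (tuple_cons B0 B) (tuple_cons C0 C) ->
  let S := psd_sqrtmx (invmx A0) in
  let T := psd_sqrtmx (invmx B0) in
  let T' := psd_sqrtmx (invmx C0) in
  [/\ pdmx B0, pdmx C0 & orth_split (tuple_mul S A S)
                           (tuple_mul T B T) (tuple_mul T' C T')].
Proof.
move=> A0pd Vunit [U [UU UU']].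
rewrite tuple_mulA -trmx_mul tuple_mul_cons tuple_dsum_cons.
set W := V *m U => /tuple_cons_inj[WA0 WA] S T T'.
have Winv : U^T *m invmx V *m W = 1%:M by rewrite /W mulmxA mulmxKV.
have Winv' : W *m (U^T *m invmx V) = 1%:M.
  by rewrite /W mulmxA -(mulmxA V) UU' mulmx1 mulmxV.
clearbody W.
have WA0pd : pdmx (block_mx B0 0 0 C0) by rewrite -WA0; exact: (pdmx_congr Winv).
have B0pd : pdmx B0.
  have := pdmx_congr (V := col_mx 1%:M 0) (W := row_mx 1%:M 0) _ WA0pd.
  rewrite mul_row_col mulmx1 mulmx0 addr0 => /(_ erefl).
  by rewrite tr_col_mx trmx1 trmx0 mul_row_block mul_row_col
    !(mul1mx, mul0mx, mulmx0, mulmx1, addr0).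
have C0pd : pdmx C0.
  have := pdmx_congr (V := col_mx 0 1%:M) (W := row_mx 0 1%:M) _ WA0pd.
  rewrite mul_row_col mulmx1 mulmx0 add0r => /(_ erefl).
  by rewrite tr_col_mx trmx1 trmx0 mul_row_block mul_row_col
    !(mul1mx, mul0mx, mulmx0, mulmx1, add0r).
split=> //.
have [Ssym Sunit SAS] := sqrt_invmxP A0pd; rewrite -/S in Ssym Sunit SAS.
have [Tsym Tunit TBT] := sqrt_invmxP B0pd; rewrite -/T in Tsym Tunit TBT.
have [T'sym T'unit T'CT'] := sqrt_invmxP C0pd; rewrite -/T' in T'sym T'unit T'CT'.
pose D := block_mx T 0 0 T'.
have Dsym : D^T = D by rewrite tr_block_mx Tsym T'sym !trmx0.
pose Q := invmx S *m W *m D.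
have SS : invmx S *m invmx S = A0.
  by rewrite -[RHS](mulKmx Sunit) -[S *m A0](mulmxK Sunit) SAS mul1mx.
have invSsym : (invmx S)^T = invmx S by rewrite trmx_inv Ssym.
have QQ : Q^T *m Q = 1%:M.
  rewrite /Q !trmx_mul invSsym Dsym -!mulmxA (mulmxA (invmx S)) SS.
  rewrite (mulmxA A0) (mulmxA W^T) (mulmxA W^T) WA0 !mulmx_block.
  rewrite !(mulmx0, mul0mx, addr0, add0r) !mulmxA TBT T'CT'.
  by rewrite -scalar_mx_block.
exists Q; split=> //.
(* [Q] is square only up to a propositional equality of sizes, so an explicit right inverse [Z] is
   exhibited; [Q^T *m Q = 1%:M] then identifies it with [Q^T]. *)
- pose Z := block_mx (invmx T) 0 0 (invmx T') *m (U^T *m invmx V) *m S.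
  have QZ : Q *m Z = 1%:M.
    have DZ : D *m block_mx (invmx T) 0 0 (invmx T') = 1%:M.
      rewrite mulmx_block !mulmx0 !mul0mx !addr0 !add0r !mulmxV //.
      by rewrite -scalar_mx_block.
    rewrite /Q /Z -!mulmxA (mulmxA D) DZ mul1mx !mulmxA -(mulmxA (invmx S)).
    rewrite -(mulmxA (invmx S)) -(mulmxA W) Winv' mulmx1; exact: mulVmx.
  have -> : Q^T = Z by rewrite -[LHS]mulmx1 -QZ mulmxA QQ mul1mx.
  exact: QZ.
- rewrite tuple_mulA /Q !trmx_mul invSsym Dsym -!mulmxA mulVmx // mulmx1.
  rewrite !mulmxA mulmxV // mul1mx.
  by rewrite -tuple_mulA WA tuple_mul_dsum.
Qed.

(** Strong induction on the size: a tuple that is not minimal has a strictly smaller defining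
    subpencil, which is again symmetric. *)
Lemma exists_minimal_defining {R : realType} {g d} {A : mxtuple R g d} :
  symtuple A -> exists e (B : mxtuple R g e),
    symtuple B /\ minimal_defining B (free_spectrahedron A).
Proof.
elim/ltn_ind: d A => d IHd A Asym.
have [Amin|] := EM (minimal_defining A (free_spectrahedron A)); first by exists d, A.
move=> /not_andP[//|/existsNP[e /existsNP[B /not_implyP[[BA ed] /contrapT AB]]]].
rewrite -AB; apply: IHd ed _ _; exact: subpencil_symtuple Asym BA.
Qed.

Lemma hom_minimal_iff {R : realType} {g d} {A0 : 'M[R]_d} {A : mxtuple R g d} :
  (0 < g)%N -> psdmx A0 -> symtuple A -> kernel_dominated A0 A ->
  let H := hom_free_spectrahedron (tuple_cons A0 A) in
  hom_bounded H ->
  hom_minimal_defining (tuple_cons A0 A) H <->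
  pdmx A0 /\
  let S := psd_sqrtmx (invmx A0) in
  minimal_defining (tuple_mul S A S) (dehomogenization H).
Proof.
move=> g_gt0 A0psd Asym A0ker H Hbounded; split=> [Amin|[A0pd [_ SASmin]]].
  have A0pd := hom_minimal_pdmx A0psd Asym A0ker Amin.
  split=> //; split; first by rewrite /H dehom_normalize.
  set S := psd_sqrtmx _ => e B [BA ed] BH.
  have [Ssym Sunit SAS] := sqrt_invmxP A0pd; rewrite -/S in Ssym Sunit SAS.
  have CE : tuple_mul S^T (tuple_cons A0 A) S = tuple_cons 1%:M (tuple_mul S A S).
    by rewrite Ssym tuple_mul_cons SAS.
  (* Minimality is applied to the congruence by [S], which turns the constant coefficient into I. *)
  case: Amin => _ /(_ S Sunit e (tuple_cons 1%:M B)); rewrite CE; case.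
    by split=> //; exact: subpencil_homogenize.
  have [unit_psd unit_ker] := pdmx_regular B (pdmxP.2 (conj psdmx1 (unitmx1 _ _))).
  symmetry; apply: hom_eq_of_dehom_eq => //.
  by rewrite -free_spectrahedron_dehom BH.
split=> // V Vunit e B [[f [C split_A]] ed] BH.
rewrite -[B]tuple_consK -[C]tuple_consK in split_A BH.
set B0 := B ord0 in split_A BH; set B' := fun j => B _ in split_A BH.
set C0 := C ord0 in split_A; set C' := fun j => C _ in split_A.
(* A splitting under an arbitrary invertible [V] becomes an orthogonal splitting of the normalized
   tuple, with summands of unchanged sizes. *)
have [B0pd BA] : pdmx B0 /\ subpencil
    (tuple_mul (psd_sqrtmx (invmx B0)) B' (psd_sqrtmx (invmx B0)))
    (tuple_mul (psd_sqrtmx (invmx A0)) A (psd_sqrtmx (invmx A0))).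
  by case: split_A => /(orth_split_normalize A0pd Vunit)[? ? ?]; split=> //;
    exists f, (tuple_mul (psd_sqrtmx (invmx C0)) C' (psd_sqrtmx (invmx C0)));
    [left | right].
apply: SASmin (conj BA ed) _.
by rewrite -dehom_normalize // BH.
Qed.

(** As [(A0, A)] need not be minimal, its kernel is first removed; the normalized tuple is then cut
    down to a minimal [M]. H and the spectrahedron of [(1, M)] have the same dehomogenization, hence
    coincide. *)
Lemma bounded_positive_homogenization {R : realType} {g d} {A0 : 'M[R]_d}
    {A : mxtuple R g d} :
  (0 < g)%N -> psdmx A0 -> symtuple A -> kernel_dominated A0 A ->
  let H := hom_free_spectrahedron (tuple_cons A0 A) in
  hom_bounded H ->
  exists e (B : mxtuple R g e),
    [/\ symtuple B, bounded_free_set (free_spectrahedron B)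
      & homogenization_of (free_spectrahedron B) H].
Proof.
move=> g_gt0 A0psd Asym A0ker H Hbounded.
have [E [B0 [B [_ B0pd Bsym _ HB]]]] := kernel_reduction A0psd Asym A0ker.
have [Ssym _ _] := sqrt_invmxP B0pd.
have SBSsym := symtuple_congr (psd_sqrtmx (invmx B0)) Bsym; rewrite Ssym in SBSsym.
have [e [M [Msym [ME Mmin]]]] := exists_minimal_defining SBSsym.
have MH : free_spectrahedron M = dehomogenization H by rewrite ME /H HB dehom_normalize.
exists e, M; split=> //; first by rewrite MH.
exists e, M; split=> //; first by split=> // ? ? /Mmin; rewrite ME.
have [unit_psd unit_ker] := pdmx_regular M (pdmxP.2 (conj psdmx1 (unitmx1 _ _))).
by apply: hom_eq_of_dehom_eq => //; rewrite -free_spectrahedron_dehom.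
Qed.

Theorem lemma2p2 (R : realType) (g d : nat) (hg : (0 < g)%N)
    (A0 : 'M[R]_d) (A : mxtuple R g d)
    (hA : symtuple (tuple_cons A0 A)) :
  let H := hom_free_spectrahedron (tuple_cons A0 A) in
  (positive_free_set H ->
    [/\ (* (1) *)
        psdmx A0 /\ (hom_minimal_defining (tuple_cons A0 A) H -> pdmx A0),
        (* (2) *)
        hom_bounded H ->
          forall (n : nat) (X0 : 'M[R]_n) (X : mxtuple R g n),
            H n (tuple_cons X0 X) ->
            let S := psd_sqrtmx (moore_penrose X0) in
            [/\ psdmx X0,
                dehomogenization H (tuple_mul S X S)
              & forall (i : 'I_g) (v : 'cV[R]_n),
                  X0 *m v = 0 -> X i *m v = 0]
      & (* (3) *)
        hom_bounded H ->
          (hom_minimal_defining (tuple_cons A0 A) H <->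
           pdmx A0 /\
           let S := psd_sqrtmx (invmx A0) in
           minimal_defining (tuple_mul S A S) (dehomogenization H))])
  /\
  (* (4) *)
  (hom_bounded H ->
    (positive_free_set H <->
     exists (e : nat) (B : mxtuple R g e),
       [/\ symtuple B,
           bounded_free_set (free_spectrahedron B)
         & homogenization_of (free_spectrahedron B) H])).
Proof.
move=> H; have [A0sym Asym] := symtuple_cons.1 hA.
split=> [/positive_regular[A0psd A0ker]|Hbounded].
  split.
  - by split=> // Amin; exact: hom_minimal_pdmx Amin.
  - move=> Hbounded n X0 X HX S; split.
    + exact: hom_bounded_psd HX.
    + exact: hom_to_dehom HX.
    + by move=> i v X0v; exact: (hom_bounded_kernel A0psd Hbounded HX).
  - move=> Hbounded; exact: hom_minimal_iff.
split=> [/positive_regular[A0psd A0ker]|[e [B [_ _ [f [M [Msym _ ->]]]]]]].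
  exact: bounded_positive_homogenization.
exact: monic_positive.
Qed.
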